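(* Let $\mathcal{Q}$ be the set of all quotients $\mathbb{K}\langle \mathbf{Mag}\rangle/_I$ where $I$ ranges over the operad ideals of $\mathbb{K}\langle \mathbf{Mag}\rangle$. For $\mathcal{O}_1=\mathbb{K}\langle \mathbf{Mag}\rangle/_{I_1}$ and $\mathcal{O}_2=\mathbb{K}\langle \mathbf{Mag}\rangle/_{I_2}$ in $\mathcal{Q}$, set $\mathcal{O}_1\wedge_{\mathrm{i}}\mathcal{O}_2:=\mathbb{K}\langle \mathbf{Mag}\rangle/_{I_1+I_2}$ and $\mathcal{O}_1\vee_{\mathrm{i}}\mathcal{O}_2:=\mathbb{K}\langle \mathbf{Mag}\rangle/_{I_1\cap I_2}$. Then $(\mathcal{Q},\preceq_{\mathrm{i}},\wedge_{\mathrm{i}},\vee_{\mathrm{i}})$ is a lattice: $\preceq_{\mathrm{i}}$ is a partial order on $\mathcal{Q}$, and for all $\mathcal{O}_1,\mathcal{O}_2\in\mathcal{Q}$, $\mathcal{O}_1\wedge_{\mathrm{i}}\mathcal{O}_2$ is their greatest lower bound and $\mathcal{O}_1\vee_{\mathrm{i}}\mathcal{O}_2$ their least upper bound for $\preceq_{\mathrm{i}}$.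
   Context: $\mathbb{K}$ is a field of characteristic zero. Operads are nonsymmetric. $\mathbf{Mag}$ is the free (set-theoretic) operad on one binary generator $\star$: $\mathbf{Mag}(n)$ is the set of binary trees with $n$ leaves, partial composition $\mathfrak{t}\circ_i\mathfrak{s}$ grafts the root of $\mathfrak{s}$ onto the $i$-th leaf (from left to right) of $\mathfrak{t}$, and the unit is the one-leaf tree. $\mathbb{K}\langle \mathbf{Mag}\rangle$ is the linear operad with $\mathbb{K}\langle \mathbf{Mag}\rangle(n)$ the vector space with basis $\mathbf{Mag}(n)$ and compositions extended bilinearly; it is the free linear operad on one binary generator $\star$. An operad ideal $I$ is a family of subspaces $I(n)\subseteq \mathbb{K}\langle \mathbf{Mag}\rangle(n)$ such that $x\circ_i y\in I$ whenever $x\in I$ or $y\in I$; $[x]_I$ denotes the class of $x$ in the quotient. Distinct ideals give distinct elements of $\mathcal{Q}$. For $\mathcal{O}_1=\mathbb{K}\langle \mathbf{Mag}\rangle/_{I_1}$, $\mathcal{O}_2=\mathbb{K}\langle \mathbf{Mag}\rangle/_{I_2}$, we write $\mathcal{O}_2\preceq_{\mathrm{i}}\mathcal{O}_1$ when there exists a nonzero morphism of linear operads from $\mathcal{O}_1$ to $\mathcal{O}_2$ (a family of arity-preserving linear maps commuting with partial compositions, nonzero on the binary generator $[\star]_{I_1}$).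
   Formalization: Reflexivity and the meet/join claims are stated only for quotients in which the class of ⋆ is nonzero; for the two ideals containing ⋆ no morphism is nonzero on [⋆], so the order is not reflexive there and the bounds fail. *)

(* Defs.v *)
From HB Require Import structures.
From mathcomp Require Import all_boot all_order all_algebra.
From mathcomp Require Import zify.

Set Implicit Arguments.
Unset Strict Implicit.
Unset Printing Implicit Defensive.

Import GRing.Theory.
Local Open Scope ring_scope.
Local Open Scope quotient_scope.

Inductive bintree := Leaf | Node of bintree & bintree.

Fixpoint gentree_of (t : bintree) : GenTree.tree unit :=
  if t is Node l r then GenTree.Node 0 [:: gentree_of l; gentree_of r]
  else GenTree.Leaf tt.

Fixpoint of_gentree (t : GenTree.tree unit) : option bintree :=
  match t with
  | GenTree.Leaf _ => Some Leaf
  | GenTree.Node _ [:: l; r] =>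
      if (of_gentree l, of_gentree r) is (Some l', Some r')
      then Some (Node l' r') else None
  | _ => None
  end.

Lemma gentree_ofK : pcancel gentree_of of_gentree.
Proof. by elim=> //= l -> r ->. Qed.

HB.instance Definition _ := Countable.copy bintree (pcan_type gentree_ofK).

Fixpoint leaves (t : bintree) : nat :=
  if t is Node l r then (leaves l + leaves r)%N else 1%N.

(* Leaves are numbered from left to right, starting at 0: the partial
   composition usually written o_i with 1 <= i <= n is indexed here by
   i - 1 : 'I_n. *)
Fixpoint graft (t : bintree) (i : nat) (s : bintree) : bintree :=
  if t is Node l r then
    if (i < leaves l)%N then Node (graft l i s) r
    else Node l (graft r (i - leaves l) s)
  else s.

Lemma leaves_gt0 t : (0 < leaves t)%N.
Proof. by elim: t => //= l Hl r _; rewrite addn_gt0 Hl. Qed.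

Lemma leaves_graft t i s :
  (i < leaves t)%N -> leaves (graft t i s) = (leaves t + leaves s).-1.
Proof.
elim: t i => [|l IHl r IHr] i //= hi.
have := leaves_gt0 l; have := leaves_gt0 r => *; case: ltnP => hl /=.
  by rewrite IHl //; lia.
by rewrite IHr; lia.
Qed.

Record Mag (n : nat) := MkMag { tree_of :> bintree; _ : leaves tree_of == n }.

HB.instance Definition _ n := [isSub of Mag n for @tree_of n].
HB.instance Definition _ n := [Countable of Mag n by <:].

Fixpoint trees_upto (h : nat) : seq bintree :=
  if h is h'.+1 then
    Leaf :: [seq Node l r | l <- trees_upto h', r <- trees_upto h']
  else [::].

Lemma mem_trees_upto h t : (leaves t <= h)%N -> t \in trees_upto h.
Proof.
elim: h t => [|h IHh] [|l r] //=; first by rewrite leqNgt addn_gt0 leaves_gt0.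
have := leaves_gt0 l; have := leaves_gt0 r => *.
by rewrite inE /=; apply: allpairs_f; apply: IHh; lia.
Qed.

Definition Mag_code n (t : Mag n) : seq_sub (trees_upto n) :=
  SeqSub (mem_trees_upto (eq_leq (eqP (valP t)))).

Definition Mag_decode n (u : seq_sub (trees_upto n)) : option (Mag n) :=
  insub (ssval u).

Lemma Mag_codeK n : pcancel (@Mag_code n) (@Mag_decode n).
Proof. by move=> t; rewrite /Mag_decode /= valK. Qed.

HB.instance Definition _ n : isFinite (Mag n) := PCanIsFinite (@Mag_codeK n).

Definition mag_star : Mag 2 := @MkMag 2 (Node Leaf Leaf) (eqxx 2).

Lemma mag_comp_subproof n m (i : 'I_n) (t : Mag n) (s : Mag m) :
  leaves (graft t i s) == (n + m).-1.
Proof. by rewrite leaves_graft ?(eqP (valP t)) // (eqP (valP s)). Qed.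

Definition mag_comp n m (i : 'I_n) (t : Mag n) (s : Mag m) : Mag (n + m).-1 :=
  @MkMag _ (graft t i s) (mag_comp_subproof i t s).

Section LinearMag.
Variable K : fieldType.

Definition KMag (n : nat) := {ffun Mag n -> K^o}.
HB.instance Definition _ n := Vector.on (KMag n).

Definition basis_elt n (t : Mag n) : KMag n := [ffun u => (u == t)%:R].

Definition star : KMag 2 := basis_elt mag_star.

Definition comp n m (i : 'I_n) (x : KMag n) (y : KMag m) : KMag (n + m).-1 :=
  \sum_(t : Mag n) \sum_(s : Mag m) (x t * y s) *: basis_elt (mag_comp i t s).

Lemma comp_is_linear_l n m (i : 'I_n) (y : KMag m) :
  linear (fun x : KMag n => comp i x y).
Proof.
move=> a x x'; rewrite /comp scaler_sumr -big_split; apply: eq_bigr => t _ /=.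
rewrite scaler_sumr -big_split; apply: eq_bigr => s _ /=.
by rewrite !ffunE mulrDl scalerDl scalerA mulrA.
Qed.

Lemma comp_is_linear_r n m (i : 'I_n) (x : KMag n) :
  linear (fun y : KMag m => comp i x y).
Proof.
move=> a y y'; rewrite /comp scaler_sumr -big_split; apply: eq_bigr => t _ /=.
rewrite scaler_sumr -big_split; apply: eq_bigr => s _ /=.
by rewrite !ffunE mulrDr scalerDl scalerA mulrCA.
Qed.

Lemma compDl n m (i : 'I_n) (x x' : KMag n) (y : KMag m) :
  comp i (x + x') y = comp i x y + comp i x' y.
Proof. by have := comp_is_linear_l i y 1 x x'; rewrite !scale1r. Qed.

Lemma compDr n m (i : 'I_n) (x : KMag n) (y y' : KMag m) :
  comp i x (y + y') = comp i x y + comp i x y'.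
Proof. by have := comp_is_linear_r i x 1 y y'; rewrite !scale1r. Qed.

Record operad_ideal := OperadIdeal {
  ideal_at :> forall n, {vspace KMag n};
  ideal_comp : forall n m (i : 'I_n) (x : KMag n) (y : KMag m),
    x \in ideal_at n \/ y \in ideal_at m ->
    comp i x y \in ideal_at (n + m).-1
}.

Lemma ideal_add_subproof (I J : operad_ideal) n m (i : 'I_n)
    (x : KMag n) (y : KMag m) :
  x \in (I n + J n)%VS \/ y \in (I m + J m)%VS ->
  comp i x y \in (I (n + m).-1 + J (n + m).-1)%VS.
Proof.
case=> /memv_addP[u Iu [v Jv ->]]; rewrite ?compDl ?compDr;
  by apply: memv_add; apply: ideal_comp; auto.
Qed.

Definition ideal_add (I J : operad_ideal) : operad_ideal :=
  OperadIdeal (@ideal_add_subproof I J).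

Lemma ideal_cap_subproof (I J : operad_ideal) n m (i : 'I_n)
    (x : KMag n) (y : KMag m) :
  x \in (I n :&: J n)%VS \/ y \in (I m :&: J m)%VS ->
  comp i x y \in (I (n + m).-1 :&: J (n + m).-1)%VS.
Proof.
rewrite !memv_cap; case=> /andP[Ix Jx];
  by apply/andP; split; apply: ideal_comp; auto.
Qed.

Definition ideal_cap (I J : operad_ideal) : operad_ideal :=
  OperadIdeal (@ideal_cap_subproof I J).

End LinearMag.

(* The library only provides the quotient of an additive group by a subgroup;
   it is equipped here with the induced scaling. *)
Section QuotientSpace.
Variables (K : fieldType) (V : vectType K) (U : {vspace V}).

Definition quotv := Quotient.quot (pred_of_vspace U).
HB.instance Definition _ := GRing.Zmodule.on quotv.
HB.instance Definition _ := EqQuotient.on quotv.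

Lemma quotv_eq (x y : V) : (\pi_quotv x == \pi_quotv y) = (x - y \in U).
Proof. by rewrite -Quotient.idealrBE. Qed.

Lemma quotv_piD (x y : V) : \pi_quotv (x + y) = \pi_quotv x + \pi_quotv y.
Proof. exact: Quotient.pi_add. Qed.

Definition quotv_scale (a : K) (x : quotv) : quotv := \pi_quotv (a *: repr x).

Lemma quotv_piZ a (x : V) : quotv_scale a (\pi_quotv x) = \pi_quotv (a *: x).
Proof.
apply/eqP; rewrite quotv_eq -scalerBr memvZ // -quotv_eq.
by rewrite reprK.
Qed.

Lemma quotv_scaleA a b x :
  quotv_scale a (quotv_scale b x) = quotv_scale (a * b) x.
Proof.
by elim/quotW: x => x; rewrite (quotv_piZ b) (quotv_piZ a) (quotv_piZ (a * b)) scalerA.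
Qed.

Lemma quotv_scale1 : left_id 1 quotv_scale.
Proof. by move=> x; elim/quotW: x => x; rewrite quotv_piZ scale1r. Qed.

Lemma quotv_scaleDr : right_distributive quotv_scale +%R.
Proof.
move=> a x y; elim/quotW: x => x; elim/quotW: y => y.
by rewrite -quotv_piD (quotv_piZ a (x + y)) !quotv_piZ -quotv_piD scalerDr.
Qed.

Lemma quotv_scaleDl x : {morph quotv_scale^~ x : a b / a + b}.
Proof.
by move=> a b; elim/quotW: x => x; rewrite !quotv_piZ -quotv_piD scalerDl.
Qed.

HB.instance Definition _ := GRing.Zmodule_isLmodule.Build K quotv
  quotv_scaleA quotv_scale1 quotv_scaleDr quotv_scaleDl.

End QuotientSpace.

Section QuotientOperad.
Variable K : fieldType.

Definition Quo (I : operad_ideal K) (n : nat) : lmodType K := quotv (I n).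

Definition qclass (I : operad_ideal K) n (x : KMag K n) : Quo I n :=
  \pi_(quotv (I n)) x.

Definition qcomp (I : operad_ideal K) n m (i : 'I_n) (x : Quo I n)
    (y : Quo I m) : Quo I (n + m).-1 :=
  qclass I (comp i (repr (x : quotv (I n))) (repr (y : quotv (I m)))).

Lemma qcomp_class (I : operad_ideal K) n m (i : 'I_n)
    (x : KMag K n) (y : KMag K m) :
  qcomp i (qclass I x) (qclass I y) = qclass I (comp i x y).
Proof.
rewrite /qcomp /qclass; set x' := repr _; set y' := repr _.
apply/eqP; rewrite quotv_eq.
have Ix : x' - x \in I n by rewrite -quotv_eq reprK.
have Iy : y' - y \in I m by rewrite -quotv_eq reprK.
have -> : comp i x' y' - comp i x y = comp i (x' - x) y' + comp i x (y' - y).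
  rewrite -[X in comp i X y' - _](subrK x) compDl -addrA; congr (_ + _).
  by rewrite -[X in comp i x X - _](subrK y) compDr addrK.
by apply: memvD; apply: ideal_comp; auto.
Qed.

Definition qstar (I : operad_ideal K) : Quo I 2 := qclass I (star K).

Definition is_operad_morphism (I1 I2 : operad_ideal K)
    (phi : forall n, {linear Quo I1 n -> Quo I2 n}) : Prop :=
  forall n m (i : 'I_n) (x : Quo I1 n) (y : Quo I1 m),
    phi (n + m).-1 (qcomp i x y) = qcomp i (phi n x) (phi m y).

(* Distinct ideals give distinct quotients, so the quotient of KMag by I is
   represented by I itself: [preceq_i I2 I1] compares KMag/I2 (the smaller) with
   KMag/I1 (the larger). Compatibility with the units need not be required: it
   follows from [phi 2 (qstar I1) != 0], the quotients having arity-1 part of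
   dimension at most 1. *)
Definition preceq_i (I2 I1 : operad_ideal K) : Prop :=
  exists2 phi : forall n, {linear Quo I1 n -> Quo I2 n},
    is_operad_morphism phi & phi 2%N (qstar I1) != 0.

Definition meet_i (I1 I2 : operad_ideal K) : operad_ideal K := ideal_add I1 I2.
Definition join_i (I1 I2 : operad_ideal K) : operad_ideal K := ideal_cap I1 I2.

Definition star_neq0 (I : operad_ideal K) : Prop := qstar I != 0.

(* There are exactly two ideals containing star (all of KMag, and its part of
   arity at least 2). No morphism from or to the corresponding quotients is
   nonzero on the generator, so preceq_i is not reflexive there. *)
Lemma preceq_i_irrefl (I : operad_ideal K) :
  ~ star_neq0 I -> ~ preceq_i I I.
Proof. by move=> /negP; rewrite negbK => /eqP I0 [phi _]; rewrite I0 linear0 eqxx. Qed.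

End QuotientOperad.

(* Main.v *)
(** A morphism [phi] from KMag/I1 to KMag/I2 that is nonzero on the generator
   sends it to [c *: star] with [c != 0], because arity 2 has dimension at most
   one; applying [phi] to [1 o star = star] then forces [phi 1 = 1]. As every
   tree with [n] leaves is a composite of [n - 1] generators, [phi] acts on
   classes in arity [n] as multiplication by [c ^ (n - 1)], so [I1] is included
   in [I2]. Conversely an inclusion induces the canonical projection, and
   [preceq_i] is thus reverse inclusion of ideals not containing [star]; such
   ideals vanish in arity 2, so they are closed under sums. *)
From HB Require Import structures.
From mathcomp Require Import all_boot all_order all_algebra.
From mathcomp Require Import zify.
From Stdlib Require Import FunctionalExtensionality ProofIrrelevance.
Require Import Defs.

Import GRing.Theory.
Local Open Scope ring_scope.

Set Implicit Arguments.
Unset Strict Implicit.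
Unset Printing Implicit Defensive.

Lemma leaves_eq1 t : leaves t = 1%N -> t = Leaf.
Proof.
by case: t => //= l r; have := leaves_gt0 l; have := leaves_gt0 r; lia.
Qed.

Lemma Mag2_star (t : Mag 2) : t = mag_star.
Proof.
case: t => t e; apply: val_inj => /=; move/eqP: e; case: t => //= l r e.
have l_gt0 := leaves_gt0 l; have r_gt0 := leaves_gt0 r.
have -> : l = Leaf by apply: leaves_eq1; lia.
by have -> : r = Leaf by apply: leaves_eq1; lia.
Qed.

Definition mag_leaf : Mag 1 := @MkMag 1 Leaf (eqxx 1%N).

Lemma Mag1_leaf (t : Mag 1) : t = mag_leaf.
Proof. by apply: val_inj; apply: leaves_eq1; apply/eqP/(valP t). Qed.

Section Linear.
Variable K : fieldType.
Implicit Types I J : operad_ideal K.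

Lemma KMag_decomp n (x : KMag K n) : x = \sum_t (x t : K) *: basis_elt K t.
Proof.
apply/ffunP => u; rewrite sum_ffunE (bigD1 u) //= big1 ?addr0.
  by rewrite !ffunE eqxx [RHS]mulr1.
by move=> t tu; rewrite !ffunE eq_sym (negPf tu) [LHS]mulr0.
Qed.

(** Meant for arities 1 and 2, where a single tree exists, so that every quotient has dimension at
    most one there. *)
Lemma KMag_decomp1 n (t : Mag n) (x : KMag K n) :
  (forall u : Mag n, u = t) -> x = (x t : K) *: basis_elt K t.
Proof.
move=> all_t; rewrite [LHS]KMag_decomp (bigD1 t) //= big1 ?addr0 //.
by move=> u; rewrite (all_t u) eqxx.
Qed.

Lemma comp_basis n m (i : 'I_n) (t : Mag n) (s : Mag m) :
  comp i (basis_elt K t) (basis_elt K s) = basis_elt K (mag_comp i t s).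
Proof.
rewrite /comp (bigD1 t) //= [X in _ + X]big1 ?addr0.
  rewrite (bigD1 s) //= big1 ?addr0 => [|u us].
    by rewrite !ffunE !eqxx mulr1 scale1r.
  by rewrite !ffunE (negPf us) mulr0 scale0r.
move=> u ut; rewrite big1 // => v _.
by rewrite !ffunE (negPf ut) mul0r scale0r.
Qed.

Lemma compZl n m (i : 'I_n) a (x : KMag K n) (y : KMag K m) :
  comp i (a *: x) y = a *: comp i x y.
Proof.
rewrite /comp scaler_sumr; apply: eq_bigr => t _.
rewrite scaler_sumr; apply: eq_bigr => s _.
by rewrite !ffunE scalerA mulrA.
Qed.

Lemma compZr n m (i : 'I_n) a (x : KMag K n) (y : KMag K m) :
  comp i x (a *: y) = a *: comp i x y.
Proof.
rewrite /comp scaler_sumr; apply: eq_bigr => t _.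
rewrite scaler_sumr; apply: eq_bigr => s _.
by rewrite !ffunE scalerA mulrCA.
Qed.

Lemma qclassD I n (x y : KMag K n) :
  qclass I (x + y) = qclass I x + qclass I y.
Proof. exact: quotv_piD. Qed.

Lemma qclassZ I n a (x : KMag K n) : qclass I (a *: x) = a *: qclass I x.
Proof. by rewrite /qclass -quotv_piZ. Qed.

Lemma qclass_eq0 I n (x : KMag K n) : (qclass I x == 0) = (x \in I n).
Proof.
(* [quotv_eq] compares two classes, so the zero of the quotient is first written as the class of
   [0]. *)
have <- : qclass I (0 : KMag K n) = 0 by rewrite -(scale0r 0) qclassZ scale0r.
by rewrite /qclass quotv_eq subr0.
Qed.

Lemma qclass_sum I n (T : finType) (F : T -> KMag K n) :
  qclass I (\sum_t F t) = \sum_t qclass I (F t).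
Proof.
apply: (big_morph _ (@qclassD I n)).
by apply/eqP; rewrite qclass_eq0 mem0v.
Qed.

Lemma qclass_repr I n (x : Quo I n) : qclass I (repr (x : quotv (I n))) = x.
Proof. exact: reprK. Qed.

Lemma star_neq0E I : star_neq0 I <-> star K \notin I 2%N.
Proof. by rewrite /star_neq0 /qstar qclass_eq0. Qed.

(** Arity 2 is the line spanned by [star]: a nonzero element of the ideal there could be rescaled to
    [star]. *)
Lemma ideal_arity2_eq0 I : star K \notin I 2%N -> I 2%N = 0%VS.
Proof.
move=> nI; apply/eqP; rewrite -subv0; apply/subvP => x.
rewrite (KMag_decomp1 x Mag2_star) memv0; apply: contraLR => x0.
have c0 : x mag_star != 0 by apply: contraNneq x0 => ->; rewrite scale0r.
apply: contra nI => Ix; have := memvZ (x mag_star : K)^-1 Ix.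
by rewrite scalerA mulVf // scale1r.
Qed.

Section Morphism.
Variables (I J : operad_ideal K) (phi : forall n, {linear Quo I n -> Quo J n}).
Hypothesis phiM : is_operad_morphism phi.
Hypothesis phi_star : phi 2%N (qstar I) != 0.

(** The class of [star] spans arity 2 of the target; were it zero, [phi] would kill the
    generator. *)
Lemma morphism_star_neq0 : star_neq0 J.
Proof.
move: phi_star; rewrite -[phi _ _]qclass_repr.
rewrite (KMag_decomp1 (repr _) Mag2_star) qclassZ.
by apply: contraNneq => Js; rewrite -/(star K) -/(qstar J) Js scaler0.
Qed.

Lemma morphism_star : exists2 c : K, c != 0 & phi 2%N (qstar I) = c *: qstar J.
Proof.
move: phi_star; rewrite -[phi _ _]qclass_repr.
rewrite (KMag_decomp1 (repr _) Mag2_star) qclassZ; set c := (X in X *: _).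
by move=> h; exists c => //; apply: contraNneq h => ->; rewrite scale0r.
Qed.

Lemma morphism_leaf :
  phi 1%N (qclass I (basis_elt K mag_leaf)) = qclass J (basis_elt K mag_leaf).
Proof.
have [c c0 phis] := morphism_star.
rewrite -[LHS]qclass_repr (KMag_decomp1 (repr _) Mag1_leaf).
set u : K := (X in X *: _); suff -> : u = 1 by rewrite scale1r.
(* The ideal [L] is arbitrary because the identity serves in the source and in the target. *)
have unit_star L : qcomp ord0 (qclass L (basis_elt K mag_leaf)) (qstar L)
    = qstar L.
  rewrite qcomp_class comp_basis; congr (qclass L (basis_elt K _)).
  exact: Mag2_star.
have := phiM ord0 (qclass I (basis_elt K mag_leaf)) (qstar I).
rewrite unit_star phis -[phi 1%N _]qclass_repr.
rewrite (KMag_decomp1 (repr _) Mag1_leaf) -/u.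
rewrite -qclassZ qcomp_class compZl compZr !qclassZ -qcomp_class unit_star.
(* Both sides are multiples of [qstar J], with coefficients [c] and [u * c]; [qstar J] and then [c]
   are cancelled, both being nonzero. *)
rewrite scalerA => /eqP; rewrite -subr_eq0 -scalerBl scaler_eq0.
rewrite (negPf morphism_star_neq0) orbF -{1}[c]mul1r -mulrBl mulf_eq0.
by rewrite (negPf c0) orbF subr_eq0 => /eqP.
Qed.

Lemma morphism_basis c : phi 2%N (qstar I) = c *: qstar J ->
  forall n (t : Mag n), phi n (qclass I (basis_elt K t))
                        = c ^+ n.-1 *: qclass J (basis_elt K t).
Proof.
move=> phis n [t]; elim: t n => [|l IHl r IHr] n e.
  have n1 : n = 1%N by rewrite -(eqP e).
  by subst n; rewrite (Mag1_leaf (MkMag e)) expr0 scale1r morphism_leaf.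
(* This is the arity of the double composition used below, so that both trees have the same type.
   The right subtree is grafted first, onto leaf 1 of the generator, which leaves the left one to be
   grafted at index 0. *)
have nE : n = ((2 + leaves r).-1 + leaves l).-1.
  by rewrite -(eqP e) /=; lia.
subst n.
pose i1 : 'I_2 := ord_max; have h0 : (0 < (2 + leaves r).-1)%N by [].
pose ml := MkMag (eqxx (leaves l)); pose mr := MkMag (eqxx (leaves r)).
have -> : MkMag e = mag_comp (Ordinal h0) (mag_comp i1 mag_star mr) ml.
  exact: val_inj.
have split_node L : qclass L (basis_elt K
      (mag_comp (Ordinal h0) (mag_comp i1 mag_star mr) ml))
    = qcomp (Ordinal h0) (qcomp i1 (qstar L) (qclass L (basis_elt K mr)))
                         (qclass L (basis_elt K ml)).
  by rewrite /qstar !qcomp_class !comp_basis.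
rewrite split_node !phiM phis IHl IHr /qstar -!qclassZ !qcomp_class.
rewrite !(compZl, compZr) !qclassZ !comp_basis !scalerA; congr (_ *: _).
(* The generator contributes one factor [c], the subtrees [leaves l - 1] and [leaves r - 1];
   positivity of the leaf counts makes the truncated predecessors add up. *)
rewrite -exprSr -exprD; congr (_ ^+ _).
by have := leaves_gt0 l; have := leaves_gt0 r; lia.
Qed.

Lemma morphism_class c : phi 2%N (qstar I) = c *: qstar J ->
  forall n (x : KMag K n), phi n (qclass I x) = c ^+ n.-1 *: qclass J x.
Proof.
move=> phis n x; rewrite (KMag_decomp x) !qclass_sum linear_sum scaler_sumr.
apply: eq_bigr => t _.
by rewrite !qclassZ linearZ /= (morphism_basis phis) !scalerA mulrC.
Qed.

Lemma morphism_ideal_sub n : (I n <= J n)%VS.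
Proof.
have [c c0 phis] := morphism_star.
apply/subvP => x; rewrite -!qclass_eq0 => /eqP Ix.
have := morphism_class phis x; rewrite Ix linear0 => /esym/eqP.
by rewrite scaler_eq0 expf_eq0 (negPf c0) andbF.
Qed.

End Morphism.

Definition quo_map I J (sIJ : forall n, (I n <= J n)%VS) n (x : Quo I n) :
  Quo J n := qclass J (repr (x : quotv (I n))).

(** The chosen representative differs from [x] by an element of [I n], hence of [J n]. *)
Lemma quo_map_class I J (sIJ : forall n, (I n <= J n)%VS) n (x : KMag K n) :
  quo_map sIJ (qclass I x) = qclass J x.
Proof.
apply/eqP; rewrite /quo_map quotv_eq; apply: (subvP (sIJ n)).
by rewrite -quotv_eq reprK.
Qed.

Lemma quo_map_linear I J (sIJ : forall n, (I n <= J n)%VS) n :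
  linear (@quo_map I J sIJ n).
Proof.
move=> a x y; rewrite -[x]qclass_repr -[y]qclass_repr.
by rewrite -qclassZ -qclassD !quo_map_class qclassD qclassZ.
Qed.

HB.instance Definition _ I J sIJ n :=
  GRing.isLinear.Build K (Quo I n) (Quo J n) *:%R (@quo_map I J sIJ n)
    (@quo_map_linear I J sIJ n).

(** Reduces the order axioms and the bounds to inclusions of subspaces in each arity. *)
Lemma preceq_iE J I :
  preceq_i J I <-> (forall n, (I n <= J n)%VS) /\ star K \notin J 2%N.
Proof.
split=> [[phi phiM phis]|[sIJ nJ]].
  split; first exact: morphism_ideal_sub phiM phis.
  exact/star_neq0E/(morphism_star_neq0 phis).
exists (fun n => @quo_map I J sIJ n) => [n m i x y|]; last first.
  by rewrite /= /qstar quo_map_class qclass_eq0.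
rewrite -[x]qclass_repr -[y]qclass_repr /=.
by rewrite qcomp_class !quo_map_class qcomp_class.
Qed.

(** Antisymmetry concludes with an equality of records: extensionality identifies the families of
    subspaces, proof irrelevance the closure proofs. *)
Lemma operad_ideal_inj I J : (forall n, I n = J n) -> I = J.
Proof.
case: I J => [I Ic] [J Jc] /= IJ.
have {}IJ : I = J by apply: functional_extensionality_dep.
by subst J; congr OperadIdeal; apply: proof_irrelevance.
Qed.

End Linear.

Theorem theorem2p1p3 (K : fieldType) (charK0 : [pchar K] =i pred0) :
  [/\ (forall O : operad_ideal K, star_neq0 O -> preceq_i O O),
      (forall O1 O2 : operad_ideal K,
          preceq_i O1 O2 -> preceq_i O2 O1 -> O1 = O2),
      (forall O1 O2 O3 : operad_ideal K,
          preceq_i O1 O2 -> preceq_i O2 O3 -> preceq_i O1 O3)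
    & forall O1 O2 : operad_ideal K, star_neq0 O1 -> star_neq0 O2 ->
      [/\ star_neq0 (meet_i O1 O2) /\ star_neq0 (join_i O1 O2),
          preceq_i (meet_i O1 O2) O1 /\ preceq_i (meet_i O1 O2) O2,
          (forall O : operad_ideal K,
              preceq_i O O1 -> preceq_i O O2 -> preceq_i O (meet_i O1 O2)),
          preceq_i O1 (join_i O1 O2) /\ preceq_i O2 (join_i O1 O2)
        & (forall O : operad_ideal K,
              preceq_i O1 O -> preceq_i O2 O -> preceq_i (join_i O1 O2) O)]].
Proof.
split=> [O /star_neq0E nO|O1 O2|O1 O2 O3|O1 O2 /star_neq0E n1 /star_neq0E n2].
- exact/preceq_iE.
- move=> /preceq_iE[s21 _] /preceq_iE[s12 _]; apply: operad_ideal_inj => n.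
  by apply/eqP; rewrite eqEsubv s12 s21.
- move=> /preceq_iE[s21 n1] /preceq_iE[s32 _]; apply/preceq_iE.
  by split=> // n; apply: subv_trans (s32 n) (s21 n).
have nM : star K \notin meet_i O1 O2 2%N.
  by rewrite /= (ideal_arity2_eq0 n2) addv0.
have nJ : star K \notin join_i O1 O2 2%N.
  by rewrite /= memv_cap (negPf n1).
split.
- by split; apply/star_neq0E.
- by split; apply/preceq_iE; split=> // n; [apply: addvSl|apply: addvSr].
(* The order reverses inclusion: a lower bound is an ideal containing both [O1] and [O2], hence
   their sum. *)
- move=> O /preceq_iE[s1 nO] /preceq_iE[s2 _]; apply/preceq_iE.
  by split=> // n; rewrite /= subv_add s1 s2.
- by split; apply/preceq_iE; split=> // n; [apply: capvSl|apply: capvSr].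
(* The join is now the target of the morphism, so the condition on the generator is [nJ]. *)
- move=> O /preceq_iE[s1 _] /preceq_iE[s2 _]; apply/preceq_iE.
  by split=> // n; rewrite /= subv_cap s1 s2.
Qed.
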